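(* Let $p$ be an odd prime, let $G$ be a finite $p$-group, and let $F$ be a finite field of characteristic $p$. Let $\circledast$ be an involution of the group algebra $FG$ that arises from the group $G$. Then $$|V_{\circledast}(FG)| = |F|^{\frac{1}{2}(|G|-|G_{\circledast}|)},$$ where $G_{\circledast}=\{\,g\in G \mid g=g^{\circledast}\,\}$.
   Context: For a finite group $G$ and a field $F$, $FG$ is the group algebra, and $\chi\left(\sum_{g\in G}\alpha_g g\right)=\sum_{g\in G}\alpha_g$ is the augmentation map. For $G$ a finite $p$-group and $F$ of characteristic $p$, $V(FG)=\{x\in FG \mid \chi(x)=1\}$ is the group of normalized units of $FG$. An involution $\circledast$ of $FG$ is said to arise from the group $G$ if it is the $F$-linear extension to $FG$ of an anti-automorphism $g\mapsto g^{\circledast}$ of $G$ (so $(gh)^{\circledast}=h^{\circledast}g^{\circledast}$ and, $\circledast$ being an involution, $(g^{\circledast})^{\circledast}=g$ for all $g,h\in G$). The $\circledast$-unitary subgroup is $V_{\circledast}(FG)=\{u\in V(FG)\mid u^{\circledast}=u^{-1}\}$, a subgroup of $V(FG)$. *)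

(* Defs.v *)
From HB Require Import structures.
From mathcomp Require Import all_boot all_order all_algebra all_fingroup.
From mathcomp Require Import all_solvable all_field.

Set Implicit Arguments.
Unset Strict Implicit.
Unset Printing Implicit Defensive.

Import GRing.Theory.
Local Open Scope ring_scope.

(* The group algebra FG of the finite group G = [set: gT]: the formal sum
   \sum_g a_g g is the coefficient function g |-> a_g.  The alias keeps the
   F-module structure of {ffun gT -> F} but not its pointwise product; the
   product of FG is convolution. *)
Definition grpalg (F : fieldType) (gT : finGroupType) := {ffun gT -> F}.
Identity Coercion ffun_of_grpalg : grpalg >-> finfun_of.

Section GroupAlgebra.

Variables (F : fieldType) (gT : finGroupType).
Local Notation FG := (grpalg F gT).
Implicit Types (x y z : FG) (g h : gT).

HB.instance Definition _ := GRing.Lmodule.copy FG {ffun gT -> F^o}.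

Definition ga_mul x y : FG := [ffun g => \sum_h x h * y (h^-1 * g)%g].

(* The image in FG of a group element. *)
Definition ga_elt g : FG := [ffun h => (h == g)%:R].

Lemma ga_mulA : associative ga_mul.
Proof.
move=> x y z; apply/ffunP=> g; rewrite !ffunE.
under eq_bigr => h _ do rewrite ffunE big_distrr /=.
under [RHS]eq_bigr => k _ do rewrite ffunE big_distrl /=.
rewrite [RHS]exchange_big /=; apply: eq_bigr => h _.
rewrite [RHS](reindex_inj (mulgI h)) /=; apply: eq_bigr => k _.
by rewrite mulKg invMg !mulgA mulrA.
Qed.

Lemma ga_mul1l : left_id (ga_elt 1%g) ga_mul.
Proof.
move=> x; apply/ffunP=> g; rewrite ffunE (bigD1 1%g) //= big1 => [|h nh1].
  by rewrite ffunE eqxx mul1r invg1 mul1g addr0.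
by rewrite ffunE (negPf nh1) mul0r.
Qed.

Lemma ga_mul1r : right_id (ga_elt 1%g) ga_mul.
Proof.
move=> x; apply/ffunP=> g; rewrite ffunE (bigD1 g) //= big1 => [|h nhg].
  by rewrite ffunE mulVg eqxx mulr1 addr0.
by rewrite ffunE -eq_mulVg1 (negPf nhg) mulr0.
Qed.

Lemma ga_mulDl : left_distributive ga_mul +%R.
Proof.
move=> x y z; apply/ffunP=> g; rewrite !ffunE -big_split /=.
by apply: eq_bigr => h _; rewrite ffunE mulrDl.
Qed.

Lemma ga_mulDr : right_distributive ga_mul +%R.
Proof.
move=> x y z; apply/ffunP=> g; rewrite !ffunE -big_split /=.
by apply: eq_bigr => h _; rewrite ffunE mulrDr.
Qed.

Lemma ga_elt1_neq0 : ga_elt 1%g != 0.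
Proof. by apply/eqP=> /ffunP/(_ 1%g)/eqP; rewrite !ffunE eqxx oner_eq0. Qed.

HB.instance Definition _ := GRing.Zmodule_isNzRing.Build FG
  ga_mulA ga_mul1l ga_mul1r ga_mulDl ga_mulDr ga_elt1_neq0.

Lemma ga_scalerAl (a : F) x y : a *: (x * y) = (a *: x) * y.
Proof.
apply/ffunP=> g; rewrite !ffunE scaler_sumr.
by apply: eq_bigr => h _; rewrite ffunE /GRing.scale /= mulrA.
Qed.

HB.instance Definition _ := GRing.Lmodule_isLalgebra.Build F FG ga_scalerAl.

Lemma ga_scalerAr (a : F) x y : a *: (x * y) = x * (a *: y).
Proof.
apply/ffunP=> g; rewrite !ffunE scaler_sumr.
by apply: eq_bigr => h _; rewrite ffunE /GRing.scale /= mulrCA.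
Qed.

HB.instance Definition _ := GRing.Lalgebra_isAlgebra.Build F FG ga_scalerAr.

Definition augmentation x : F := \sum_g x g.

(* An involution of FG as a ring: an additive antimultiplicative map that is
   its own inverse. *)
Definition ga_involution (star : FG -> FG) : Prop :=
  [/\ {morph star : x y / x + y},
      forall x y, star (x * y) = star y * star x
    & involutive star].

Definition anti_automorphism (s : gT -> gT) : Prop :=
  bijective s /\ (forall g h, s (g * h)%g = (s h * s g)%g).

Definition linear_extension (s : gT -> gT) (x : FG) : FG :=
  \sum_g x g *: ga_elt (s g).

Definition arises_from_group (star : FG -> FG) : Prop :=
  exists2 s : gT -> gT, anti_automorphism s & star =1 linear_extension s.

(* The elements outside this set are paired by g |-> g^star when star is an
   involution arising from the group, so halving their number is exact. *)
Definition fixed_elements (star : FG -> FG) : {set gT} :=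
  [set g | ga_elt g == star (ga_elt g)].

End GroupAlgebra.

Section FiniteGroupAlgebra.

Variables (F : finFieldType) (gT : finGroupType).
Local Notation FG := (grpalg F gT).

HB.instance Definition _ := Finite.on FG.
HB.instance Definition _ := FinRing.isNzRing.Build FG.

Definition normalized_units : {set FG} := [set x | augmentation x == 1].

(* The conjunct u \is a GRing.unit only guards against the convention
   u^-1 = u for non-units; it is automatic when [set: gT] is a p-group and F
   has characteristic p, as every x with augmentation 1 is then a unit. *)
Definition unitary_subgroup (star : FG -> FG) : {set FG} :=
  [set u in normalized_units | (u \is a GRing.unit) && (star u == u^-1)].

End FiniteGroupAlgebra.

(* Main.v *)
Require Import Defs.
From mathcomp Require Import all_boot all_order all_algebra all_fingroup.
From mathcomp Require Import all_solvable all_field.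

(* The Cayley transform u |-> (1 - u) / (1 + u) is its own inverse where it is
   defined, and exchanges u^-1 with opposites, so it matches the unitary units
   with the skew elements, star k = - k.  It is defined on both sets because
   every element of nonzero augmentation is a unit: the augmentation of 1 + u is
   2 for u unitary, and 1 for u skew.  A skew element is determined by its
   coefficients on one element of each pair g != g^star, the coefficients at the
   fixed elements being 0. *)

Set Implicit Arguments.
Unset Strict Implicit.
Unset Printing Implicit Defensive.

Import GRing.Theory.

(** * Counting functions that are skew under an involution of a finite set *)

Section SkewFunctions.

Local Open Scope ring_scope.

Variables (T : finType) (F : finFieldType) (s : T -> T).
Hypotheses (sK : involutive s) (two_neq0 : 2%:R != 0 :> F).

(* One representative of each pair {i, s i} of distinct points. *)
Let half : {set T} := [set i | enum_rank i < enum_rank (s i)]%N.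

Lemma half_involution i : (s i \in half) = (s i != i) && (i \notin half).
Proof.
by rewrite !inE sK -leqNgt ltn_neqAle -(inj_eq enum_rank_inj) -val_eqE.
Qed.

(** Away from its fixed points [s] exchanges [half] with its complement, so the moved points number
    exactly twice [#|half|]. *)
Lemma card_half : #|half| = ((#|T| - #|[set i | s i == i]|) %/ 2)%N.
Proof.
have -> : (#|T| - #|[set i | s i == i]| = #|half| * 2)%N; last by rewrite mulnK.
rewrite -[in LHS](setCK [set i | _]) -cardsCs -(cardsID half) muln2 -addnn.
congr (_ + _)%N.
  apply: eq_card => i; rewrite !inE andb_idl // => lt_i.
  by apply: contraTneq lt_i => ->; rewrite ltnn.
rewrite -(card_imset half (inv_inj sK)); apply: eq_card => i.
rewrite -[i]sK (mem_imset _ _ (inv_inj sK)) !inE sK.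
by rewrite -leqNgt ltn_neqAle val_eqE (inj_eq enum_rank_inj) [RHS]andbC.
Qed.

(** Restriction to [half], extended by 0, is a bijection from the skew functions onto the functions
    supported in [half]: the other values are forced by skewness, and vanish at fixed points because
    2 is nonzero in [F]. *)
Lemma card_skew_ffun :
  #|[set f : {ffun T -> F} | [forall i, f (s i) == - f i]]| =
    (#|F| ^ ((#|T| - #|[set i | s i == i]|) %/ 2))%N.
Proof.
rewrite -card_half -(card_pffun_on 0).
set A := [set f | _].
pose res (f : {ffun T -> F}) := [ffun i => if i \in half then f i else 0].
have skew f i : f \in A -> f (s i) = - f i.
  by rewrite inE => /forallP/(_ i)/eqP.
have injA : {in A &, injective res}.
  move=> f g Af Ag /ffunP eq_fg; apply/ffunP => i.
  have half_eq j : j \in half -> f j = g j.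
    by move=> hj; have := eq_fg j; rewrite !ffunE hj.
  have [hi | nhi] := boolP (i \in half); first exact: half_eq.
  have [si | nsi] := eqVneq (s i) i; last first.
    apply: oppr_inj; rewrite -!skew // half_eq //.
    by rewrite half_involution nsi.
  have fix0 h : h \in A -> h i = 0.
    move=> Ah; have /eqP := skew h i Ah.
    rewrite si -subr_eq0 opprK -mulr2n -mulr_natl mulf_eq0 (negPf two_neq0).
    by move/eqP.
  by rewrite !fix0.
rewrite -(card_in_imset injA); apply: eq_card => g.
apply/imsetP/pffun_onP => [[f Af ->] | [/supportP g0 _]].
  by split=> //; apply/supportP => i /negPf nhi; rewrite ffunE nhi.
exists [ffun i => g i - g (s i)].
  by rewrite inE; apply/forallP => i; rewrite !ffunE sK opprB.
apply/ffunP => i; rewrite !ffunE; case: ifPn => [hi | /g0 //].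
by rewrite [g (s i)]g0 ?subr0 // half_involution hi andbF.
Qed.

End SkewFunctions.

(** * Elements of nonzero augmentation are units *)

Section AugmentationUnits.

Local Open Scope ring_scope.

(** Lagrange: [S] is an additive subgroup, in which [y] has order exactly [p]. *)
Lemma dvdn_card_zmod_closed (p : nat) (U : finZmodType) (S : {set U}) (y : U) :
  prime p -> zmod_closed S -> y \in S -> y != 0 -> y *+ p = 0 -> (p %| #|S|)%N.
Proof.
move=> p_pr [S0 SB] Sy y0 yp.
have gS : group_set S.
  apply/group_setP; split=> // a b Sa Sb.
  by rewrite FinRing.zmodMgE -[b]opprK SB // -[- b]sub0r SB.
rewrite -(nt_prime_order p_pr yp y0).
exact: (@order_dvdG _ (Group gS)).
Qed.

Section Grpalg.

Variables (F : fieldType) (gT : finGroupType).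
Local Notation FG := (grpalg F gT).
Implicit Types (x y : FG) (g h : gT).

Lemma ga_mulE x y g : (x * y) g = \sum_h x h * y (h^-1 * g)%g.
Proof. by rewrite ffunE. Qed.

Lemma mul_ga_eltE y g h : (y * ga_elt F g) h = y (h * g^-1)%g.
Proof.
rewrite ga_mulE (bigD1 (h * g^-1)%g) //= big1 => [|k nk].
  by rewrite ffunE invMg invgK mulgKV eqxx mulr1 addr0.
rewrite ffunE (_ : _ == g = false) ?mulr0 //.
by apply: contraNF nk => /eqP <-; rewrite invMg invgK mulKVg.
Qed.

Lemma ga_eltM g h : ga_elt F g * ga_elt F h = ga_elt F (g * h)%g.
Proof.
by apply/ffunP=> k; rewrite mul_ga_eltE !ffunE -(inj_eq (mulIg h)) mulgKV.
Qed.

Lemma ga_elt1 : ga_elt F (1%g : gT) = 1.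
Proof. by []. Qed.

Lemma augmentation1 : augmentation (1 : FG) = 1.
Proof.
rewrite /augmentation (bigD1 1%g) //= big1 => [|g ng].
  by rewrite ffunE eqxx addr0.
by rewrite ffunE (negPf ng).
Qed.

Lemma augmentationD x y :
  augmentation (x + y) = augmentation x + augmentation y.
Proof. by rewrite -big_split; apply: eq_bigr => g _; rewrite ffunE. Qed.

Lemma augmentationN x : augmentation (- x) = - augmentation x.
Proof. by rewrite -sumrN; apply: eq_bigr => g _; rewrite ffunE. Qed.

Lemma augmentationM x y :
  augmentation (x * y) = augmentation x * augmentation y.
Proof.
rewrite /augmentation; under eq_bigr => g _ do rewrite ga_mulE.
rewrite exchange_big /= mulr_suml; apply: eq_bigr => h _.
by rewrite (reindex_inj (mulgI h)) mulr_sumr; under eq_bigr do rewrite mulKg.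
Qed.

(** A constant function is a multiple of the sum of all group elements, which each group element
    fixes under left multiplication. *)
Lemma mul_const_ga x y g : (forall h, y h = y 1%g) ->
  (x * y) g = augmentation x * y 1%g.
Proof.
move=> y_const; rewrite ga_mulE mulr_suml.
by apply: eq_bigr => h _; rewrite y_const.
Qed.

End Grpalg.

Variables (p : nat) (F : finFieldType) (gT : finGroupType).
Local Notation FG := (grpalg F gT).
Hypotheses (p_pr : prime p) (pG : (p.-group [set: gT])%g).
Hypothesis charF : p \in [pchar F].

(* The right annihilator of x is a right ideal, so G acts on it by right
   multiplication.  If it is nonzero then p divides its order, hence so does
   the number of its G-fixed points; these are the constant functions, and x
   multiplies a constant function by the augmentation of x. *)
Lemma ga_regular (x y : FG) : augmentation x != 0 -> x * y = 0 -> y = 0.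
Proof.
move=> aug_x xy0; apply/eqP/negPn/negP => y_neq0.
pose K : {set FG} := [set z | x * z == 0].
have to1 : (fun z : FG => z * ga_elt F 1%g) =1 id.
  by move=> z; rewrite ga_elt1 mulr1.
have toM (z : FG) : act_morph (fun (z : FG) g => z * ga_elt F g) z.
  by move=> g h; rewrite -mulrA ga_eltM.
pose to := TotalAction to1 toM.
have actsK : [acts [set: gT], on K | to].
  apply/actsP => g _ z; rewrite !inE /= mulrA.
  apply/eqP/eqP => [xzg | ->]; last by rewrite mul0r.
  by rewrite -[x * z]mulr1 -ga_elt1 -(mulgV g) -ga_eltM mulrA xzg mul0r.
have pK : (p %| #|K|)%N.
  apply: (@dvdn_card_zmod_closed p FG K y) => //; last 1 first.
  - by apply/ffunP => g; rewrite ffunMnE ffunE -mulr_natl (pcharf0 charF) mul0r.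
  - split=> [|a b]; rewrite !inE ?mulr0 // => /eqP xa /eqP xb.
    by rewrite mulrBr xa xb subr0.
  by rewrite inE xy0.
have := pgroup_fix_mod pG actsK; rewrite (eqP pK) => /esym/eqP pfix.
(* Since 0 is fixed, the number of fixed points is a positive multiple of [p], which leaves room for
   a nonzero one. *)
have fix0 : 0 \in 'Fix_(K | to)([set: gT])%g.
  by apply/setIP; rewrite inE mulr0; split=> //; apply/afixP => g _; apply: mul0r.
have : (1 < #|'Fix_(K | to)([set: gT])%g|)%N.
  apply: leq_trans (prime_gt1 p_pr) (dvdn_leq _ pfix).
  by apply/card_gt0P; exists 0.
rewrite (cardD1 0) fix0 ltnS => /card_gt0P[z /andP[z_neq0 /setIP[]]].
rewrite inE => /eqP/ffunP xz0 /afixP fix_z; case/negP: z_neq0.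
have z_const h : z h = z 1%g.
  have /ffunP/(_ h) := fix_z h (in_setT h).
  by rewrite mul_ga_eltE mulgV.
have /eqP := xz0 1%g; rewrite mul_const_ga // ffunE mulf_eq0 (negPf aug_x) /=.
by move/eqP=> z1; apply/eqP/ffunP => h; rewrite z_const z1 ffunE.
Qed.

(** By regularity, left multiplication by [x] is injective, hence surjective on the finite set [FG],
    so [x] has a right inverse [y]. As [y] also has nonzero augmentation, it has a right inverse
    too, which must be [x]. *)
Lemma ga_unit (x : FG) : augmentation x != 0 -> x \is a GRing.unit.
Proof.
have right_inv (z : FG) : augmentation z != 0 -> exists t, z * t = 1.
  move=> aug_z; have inj : injective (fun t => z * t).
    move=> a b /eqP; rewrite -subr_eq0 -mulrBr => /eqP/(ga_regular aug_z)/eqP.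
    by rewrite subr_eq0 => /eqP.
  by exists (invF inj 1); apply: (f_invF inj).
move=> aug_x; have [y xy1] := right_inv x aug_x.
have aug_y : augmentation y != 0.
  apply: contra_eqN (augmentation1 F gT) => /eqP aug_y0.
  by rewrite -xy1 augmentationM aug_y0 mulr0 eq_sym oner_eq0.
have [z yz1] := right_inv y aug_y.
apply/unitrP; exists y; split=> //.
by rewrite -[x]mulr1 -yz1 [x * _]mulrA xy1 mul1r.
Qed.

End AugmentationUnits.

(** * The Cayley transform in a noncommutative ring *)

Section Cayley.

Local Open Scope ring_scope.

Variable R : unitRingType.
Implicit Types u k : R.

Definition cayley u : R := (1 - u) / (1 + u).

(** Reduces [cayleyV], [cayleyK] and [star_cayley] to one equation without a denominator on the
    right of [v]. *)
Lemma cayley_unique u v :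
  1 + u \is a GRing.unit -> v * (1 + u) = 1 - u -> v = cayley u.
Proof. by move=> Uu def_v; rewrite /cayley -def_v mulrK. Qed.

Lemma comm_1D1B u : GRing.comm (1 - u) (1 + u).
Proof.
apply: commrD; first exact: commr1.
by apply/commr_sym/commrB; [apply: commr1 | apply: commr_refl].
Qed.

Lemma cayleyN k : 1 + k \is a GRing.unit -> 1 - k \is a GRing.unit ->
  cayley (- k) = (cayley k)^-1.
Proof.
by move=> Uk UNk; rewrite /cayley opprK invrM ?unitrV // invrK.
Qed.

Lemma cayleyV u : u \is a GRing.unit -> 1 + u \is a GRing.unit ->
  cayley u^-1 = - cayley u.
Proof.
move=> Uu U1u; have def1V : 1 + u^-1 = (1 + u) * u^-1.
  by rewrite mulrDl mul1r mulrV // addrC.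
apply/esym/cayley_unique; first by rewrite def1V unitrMl ?unitrV.
by rewrite def1V mulrA mulNr divrK // mulNr mulrBl mul1r mulrV // opprB.
Qed.

Lemma cayleyD1 u : 1 + u \is a GRing.unit -> 1 + cayley u = 2%:R / (1 + u).
Proof.
by move=> U1u; rewrite -[X in X + _](mulrV U1u) -mulrDl addrACA subrr addr0.
Qed.

Lemma cayley_unitD1 u : (2%:R : R) \is a GRing.unit ->
  1 + u \is a GRing.unit -> 1 + cayley u \is a GRing.unit.
Proof. by move=> U2 U1u; rewrite cayleyD1 // unitrMl ?unitrV. Qed.

Lemma cayleyK u : (2%:R : R) \is a GRing.unit -> 1 + u \is a GRing.unit ->
  cayley (cayley u) = u.
Proof.
move=> U2 U1u; apply/esym/cayley_unique; first exact: cayley_unitD1.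
(* Both sides equal [2u / (1 + u)]. *)
rewrite cayleyD1 // mulrA mulr_natr -[X in _ = X - _](mulrV U1u) -mulrBl.
by rewrite opprB (addrC (1 + u)) addrA subrK -mulr2n.
Qed.

End Cayley.

(** * Compatibility of the Cayley transform with an anti-involution *)

Section AntiInvolution.

Local Open Scope ring_scope.

Variables (R : unitRingType) (star : R -> R).
Hypothesis starD : {morph star : x y / x + y}.
Hypothesis starM : forall x y, star (x * y) = star y * star x.
Hypothesis starK : involutive star.

Lemma star1 : star 1 = 1.
(* The second factor of [star 1 * 1] is read as [star (star 1)]. *)
Proof. by rewrite -[LHS]mulr1 -{2}[1]starK -starM mulr1 starK. Qed.

Lemma starN x : star (- x) = - star x.
Proof.
have star0 : star 0 = 0 by apply: (addrI (star 0)); rewrite -starD !addr0.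
by apply: (addrI (star x)); rewrite -starD !subrr.
Qed.

Lemma star_cayley u :
  1 + u \is a GRing.unit -> star (cayley u) = cayley (star u).
Proof.
move=> U1u; have star1D : star (1 + u) = 1 + star u by rewrite starD star1.
have starVl : star (1 + u)^-1 * (1 + star u) = 1.
  by rewrite -star1D -starM mulrV // star1.
have starVr : (1 + star u) * star (1 + u)^-1 = 1.
  by rewrite -star1D -starM mulVr // star1.
have Us : 1 + star u \is a GRing.unit.
  by apply/unitrP; exists (star (1 + u)^-1).
apply: cayley_unique => //.
(* [star] puts the inverse on the left of the numerator; commuting [1 - star u] past [1 + star u]
   lets it cancel. *)
by rewrite starM starD starN star1 -mulrA comm_1D1B mulrA starVl mul1r.
Qed.

End AntiInvolution.

(** * Linear extension of an injective map of the group *)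

Section GroupInvolution.

Local Open Scope ring_scope.

Variables (F : fieldType) (gT : finGroupType) (s : gT -> gT).
Local Notation FG := (grpalg F gT).
Implicit Types (x : FG) (g : gT).

Lemma ga_elt_inj : injective (@ga_elt F gT).
Proof.
move=> g h /ffunP/(_ g)/eqP; rewrite !ffunE eqxx.
by case: (g =P h) => // _; rewrite oner_eq0.
Qed.

Hypothesis s_inj : injective s.

Lemma linear_extensionE x g : linear_extension s x (s g) = x g.
Proof.
rewrite /linear_extension sum_ffunE (bigD1 g) //= big1 => [|h nhg].
  by rewrite !ffunE eqxx addr0; apply: mulr1.
by rewrite !ffunE (inj_eq s_inj) eq_sym (negPf nhg); apply: mulr0.
Qed.

Lemma linear_extension_elt g :
  linear_extension s (ga_elt F g) = ga_elt F (s g).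
Proof.
rewrite /linear_extension (bigD1 g) //= big1 => [|h nhg].
  by rewrite ffunE eqxx scale1r addr0.
by rewrite ffunE (negPf nhg) scale0r.
Qed.

Lemma augmentation_linear_extension x :
  augmentation (linear_extension s x) = augmentation x.
Proof.
rewrite /augmentation (reindex_inj s_inj).
by under eq_bigr do rewrite linear_extensionE.
Qed.

End GroupInvolution.

(** * Matching unitary units with skew elements *)

Section UnitarySubgroup.

Local Open Scope ring_scope.

Variables (p : nat) (F : finFieldType) (gT : finGroupType).
Local Notation FG := (grpalg F gT).
Hypotheses (p_pr : prime p) (pG : (p.-group [set: gT])%g).
Hypothesis charF : p \in [pchar F].
Hypothesis two_neq0 : 2%:R != 0 :> F.

Variable star : FG -> FG.
Hypothesis star_inv : ga_involution star.
Hypothesis aug_star : forall x, augmentation (star x) = augmentation x.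

Lemma card_unitary_subgroup :
  #|unitary_subgroup star| = #|[set k | star k == - k]|.
Proof.
have [starD starM starK] := star_inv.
have unit_aug (x : FG) : augmentation x != 0 -> x \is a GRing.unit.
  exact: (ga_unit p_pr pG charF).
have U2 : (2%:R : FG) \is a GRing.unit.
  by apply: unit_aug; rewrite augmentationD augmentation1.
have unit1DV (u : FG) : u \in unitary_subgroup star -> 1 + u \is a GRing.unit.
  rewrite !inE => /andP[/eqP aug_u _].
  by apply: unit_aug; rewrite augmentationD augmentation1 aug_u.
(* [star] preserves the augmentation, so that of a skew element equals its own opposite. *)
have aug_skew (k : FG) : star k = - k -> augmentation k = 0.
  move=> star_k; have /eqP := aug_star k.
  rewrite star_k augmentationN eq_sym -subr_eq0 opprK -mulr2n -mulr_natl.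
  by rewrite mulf_eq0 (negPf two_neq0) => /eqP.
have unit1D (k : FG) : augmentation k = 0 -> 1 + k \is a GRing.unit.
  move=> aug_k; apply: unit_aug.
  by rewrite augmentationD augmentation1 aug_k addr0 oner_eq0.
have injV : {in unitary_subgroup star &, injective (@cayley FG)}.
  move=> u v Vu Vv eq_uv.
  by rewrite -(cayleyK U2 (unit1DV u Vu)) eq_uv cayleyK // unit1DV.
rewrite -(card_in_imset injV); apply: eq_card => k; rewrite inE.
apply/imsetP/eqP => [[u Vu ->] | star_k].
  rewrite (star_cayley starD starM starK) ?unit1DV //.
  by have:= Vu; rewrite inE => /and3P[_ Uu /eqP->]; rewrite cayleyV ?unit1DV.
have aug_k := aug_skew k star_k; have U1k := unit1D k aug_k.
have U1Nk : 1 - k \is a GRing.unit.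
  by rewrite unit1D // augmentationN aug_k oppr0.
exists (cayley k); last by rewrite cayleyK.
rewrite !inE (star_cayley starD starM starK) // star_k cayleyN // eqxx.
rewrite unitrMl ?unitrV // U1Nk /= andbT; apply/eqP.
(* The augmentation of [cayley k] is read off from [cayley k * (1 + k) = 1 - k], where both [1 + k]
   and [1 - k] have augmentation 1. *)
have := augmentationM (cayley k) (1 + k).
rewrite divrK // !augmentationD augmentationN augmentation1 aug_k.
by rewrite oppr0 addr0 mulr1.
Qed.

End UnitarySubgroup.

Theorem theorem1 (p : nat) (gT : finGroupType) (F : finFieldType)
    (star : grpalg F gT -> grpalg F gT) :
  prime p -> odd p ->
  (p.-group [set: gT])%g ->
  (p \in [pchar F])%R ->
  ga_involution star -> arises_from_group star ->
  #|unitary_subgroup star| =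
    (#|F| ^ ((#|[set: gT]| - #|fixed_elements star|) %/ 2))%N.
Proof.
move=> p_pr p_odd pG charF star_inv [s [s_bij _] starE].
have [_ _ starK] := star_inv; have s_inj := bij_inj s_bij.
have star_elt g : star (ga_elt F g) = ga_elt F (s g).
  by rewrite starE linear_extension_elt.
(* [s] inherits involutivity from [star] through the embedding of the group in [FG]. *)
have sK : involutive s.
  by move=> g; apply: (@ga_elt_inj F); rewrite -!star_elt starK.
have two_neq0 : (2%:R != 0 :> F)%R.
  rewrite -(dvdn_pcharf charF) dvdn_prime2 //.
  by apply: contraTneq p_odd => ->.
have aug_star x : augmentation (star x) = augmentation x.
  by rewrite starE augmentation_linear_extension.
have fixedE : fixed_elements star = [set g | s g == g].
  by apply/setP => g; rewrite !inE star_elt (inj_eq (@ga_elt_inj F gT)) eq_sym.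
rewrite (card_unitary_subgroup p_pr pG charF two_neq0 star_inv aug_star).
rewrite cardsT fixedE -(card_skew_ffun sK two_neq0); apply: eq_card => k.
(* The coefficient of [star k] at [s g] is [k g], so [star k = - k] is skewness of the coefficient
   function under [s]. *)
rewrite !inE; apply/eqP/forallP => [star_k g | skew_k].
  by rewrite -[k g](linear_extensionE s_inj) -starE star_k ffunE opprK.
apply/ffunP => g; rewrite -[g]sK starE linear_extensionE // ffunE.
by rewrite (eqP (skew_k _)) sK.
Qed.
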